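(* Let $k\in[1,n-1]$ be an integer. A Riemannian $n$-manifold has $(n-k)$-positive Ricci curvature if and only if it has $k$-positive $\mathrm{Ein}_k$ curvature. In particular, positive Ricci curvature is equivalent to $(n-1)$-positive $\mathrm{Ein}_{n-1}$ curvature; also (case $k=2$, so $n\ge 3$) $(n-2)$-positive Ricci curvature is equivalent to $2$-positive $\mathrm{Ein}_2$ curvature.
   Context: For a Riemannian metric $g$, $\mathrm{Ein}_k:=\mathrm{Scal}\cdot g-k\,\mathrm{Ric}$, with $\mathrm{Ric}$ and $\mathrm{Scal}$ the Ricci tensor and scalar curvature. A symmetric operator on a real inner product space is $m$-positive if the sum of its lowest $m$ eigenvalues (with multiplicity) is positive; a symmetric $2$-tensor on a Riemannian manifold is $m$-positive if the associated operator (via $g$) is $m$-positive at each point. *)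

(* Defs.v *)
(* MathComp / MathComp-Analysis *)
From HB Require Import structures.
From mathcomp Require Import all_boot all_order all_algebra.
From mathcomp Require Import all_classical all_reals all_analysis.

Set Implicit Arguments.
Unset Strict Implicit.
Unset Printing Implicit Defensive.

Import Order.TTheory GRing.Theory Num.Theory.
Import numFieldNormedType.Exports.

Local Open Scope classical_set_scope.
Local Open Scope ring_scope.

(* Vectors are rows: a bilinear form of matrix T is (v, w) |-> v *m T *m w^T
   and an operator of matrix S is v |-> v *m S. *)
Section LinearAlgebra.
Context {R : realType} {n : nat}.
Implicit Types (g T S : 'M[R]_n) (v w : 'rV[R]_n).

Definition form T v w : R := (v *m T *m w^T) 0 0.

Definition symmetric_form T : Prop := forall v w, form T v w = form T w v.

Definition positive_form T : Prop :=
  symmetric_form T /\ forall v, v != 0 -> 0 < form T v v.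

(* The operator S such that g(v S, w) = T(v, w), for g an inner product. *)
Definition assoc_op g T : 'M[R]_n := T *m invmx g.

Definition symmetric_op g S : Prop :=
  forall v w, form g (v *m S) w = form g v (w *m S).

(* The eigenvalues of S, with multiplicity, in nondecreasing order. *)
Definition ordered_spectrum S (s : seq R) : Prop :=
  sorted <=%R s /\ char_poly S = \prod_(a <- s) ('X - a%:P).

(* m-positivity is a property of symmetric operators, hence the first clause.
   The ordered spectrum is then unique, and it exists when g is an inner
   product. *)
Definition m_positive_op g (m : nat) S : Prop :=
  symmetric_op g S /\
  exists2 s, ordered_spectrum S s & 0 < \sum_(a <- take m s) a.

End LinearAlgebra.

Section Smoothness.
Context {R : realType} {n : nat}.

Definition partial (i : 'I_n) (f : 'rV[R]_n -> R) : 'rV[R]_n -> R :=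
  'D_(delta_mx 0 i) f.

(* C^oo on the open set U: all iterated partial derivatives are
   differentiable at every point of U. *)
Definition smooth_on (U : set 'rV[R]_n) (f : 'rV[R]_n -> R) : Prop :=
  forall (l : seq 'I_n) x, U x -> differentiable (foldr partial f l) x.

End Smoothness.

Record chart (R : realType) (n : nat) (M : topologicalType) := Chart {
  chart_dom : set M;
  chart_map :> M -> 'rV[R]_n;
  chart_inv : 'rV[R]_n -> M;
  chart_dom_open : open chart_dom;
  chart_codom_open : open (chart_map @` chart_dom);
  chart_mapK : forall p, chart_dom p -> chart_inv (chart_map p) = p;
  chart_map_continuous : {within chart_dom, continuous chart_map};
  chart_inv_continuous :
    {within chart_map @` chart_dom, continuous chart_inv}
}.

(* Smooth n-manifold (without boundary, not necessarily connected) with a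
   smooth Riemannian metric. The metric is given by its components in the
   charts of the atlas (not required to be maximal), as functions of the
   coordinates:
   metric c x i j = g(d_i, d_j) at the point of coordinates x in c. *)
Record riemannianManifold (R : realType) (n : nat) := RiemannianManifold {
  carrier :> topologicalType;
  carrier_hausdorff : hausdorff_space carrier;
  carrier_second_countable : @second_countable carrier;
  atlas : set (chart R n carrier);
  atlas_cover : forall p : carrier, exists2 c, atlas c & chart_dom c p;
  atlas_smooth : forall c d, atlas c -> atlas d ->
    forall j : 'I_n,
      smooth_on (c @` (chart_dom c `&` chart_dom d))
        (fun x => d (chart_inv c x) 0 j);
  metric : chart R n carrier -> 'rV[R]_n -> 'M[R]_n;
  metric_smooth : forall c, atlas c -> forall i j : 'I_n,
    smooth_on (c @` chart_dom c) (fun x => metric c x i j);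
  metric_inner : forall c, atlas c -> forall p, chart_dom c p ->
    positive_form (metric c (c p));
  (* g_c = J g_d J^T, with J the Jacobian of the transition from c to d
     (entry (i, j) of J is d y_j / d x_i) *)
  metric_compat : forall c d, atlas c -> atlas d ->
    forall p, chart_dom c p -> chart_dom d p ->
      let J := 'J (d \o chart_inv c) (c p) in
      metric c (c p) = J *m metric d (d p) *m J^T
}.

(* Curvature in local coordinates, g being the matrix of the metric as a
   function of the coordinates. *)
Section Curvature.
Context {R : realType} {n : nat}.
Variable g : 'rV[R]_n -> 'M[R]_n.
Implicit Types (x : 'rV[R]_n) (i j k l : 'I_n).

(* Levi-Civita connection: nabla_(d_i) d_j = \sum_k christoffel k i j d_k *)
Definition christoffel k i j x : R :=
  2^-1 * \sum_l invmx (g x) k l *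
    (partial i (fun y => g y j l) x + partial j (fun y => g y i l) x
     - partial l (fun y => g y i j) x).

(* R(d_i, d_j) d_k = \sum_l riemann l k i j d_l, with the convention
   R(X, Y) = nabla_X nabla_Y - nabla_Y nabla_X - nabla_[X, Y] *)
Definition riemann l k i j x : R :=
  partial i (christoffel l j k) x - partial j (christoffel l i k) x
  + \sum_m (christoffel l i m x * christoffel m j k x
            - christoffel l j m x * christoffel m i k x).

(* Ric(Y, Z) = trace (X |-> R(X, Y) Z), positive on round spheres *)
Definition ricci_coord x : 'M[R]_n :=
  \matrix_(j, k) \sum_i riemann i k i j x.

Definition scal_coord x : R := \tr (assoc_op (g x) (ricci_coord x)).

Definition ein_coord (k : nat) x : 'M[R]_n :=
  scal_coord x *: g x - k%:R *: ricci_coord x.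

End Curvature.

Section Tensors.
Context {R : realType} {n : nat} (M : riemannianManifold R n).

(* 2-tensor fields, by their components in each chart, as for metric. *)
Definition tensor2 := chart R n M -> 'rV[R]_n -> 'M[R]_n.

Definition Ric : tensor2 := fun c => ricci_coord (@metric R n M c).

Definition Ein (k : nat) : tensor2 := fun c => ein_coord (@metric R n M c) k.

Definition positive_tensor (T : tensor2) : Prop :=
  forall (p : M) (c : chart R n M), atlas c -> chart_dom c p ->
    positive_form (T c (c p)).

Definition m_positive_tensor (m : nat) (T : tensor2) : Prop :=
  forall (p : M) (c : chart R n M), atlas c -> chart_dom c p ->
    let g := metric c (c p) in
    m_positive_op g m (assoc_op g (T c (c p))).

End Tensors.

Arguments Ric {R n} M.
Arguments Ein {R n} M k.
Arguments positive_tensor {R n} M T.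
Arguments m_positive_tensor {R n} M m T.

(* Main.v *)
(* At each point, if a_1 <= ... <= a_n are the Ricci eigenvalues and c is their
   sum, the Ein_k eigenvalues are c - k a_i in reverse order. The k lowest of
   them sum to k c - k (a_(n-k+1) + ... + a_n) = k (a_1 + ... + a_(n-k)).
   For positive Ricci curvature, one must also identify positive definiteness
   with positivity of the lowest eigenvalue: the eigenvalues of a positive
   definite form are real and positive by computing with the real and imaginary
   parts of complex eigenvectors, and conversely the form is bounded below by
   its lowest eigenvalue, the minimum of the Rayleigh quotient. *)
Require Import Defs.
From mathcomp Require Import all_boot all_order all_algebra.
From mathcomp Require Import all_classical all_reals all_analysis.
From mathcomp Require complex.
From mathcomp Require Import zify ring.

Import Order.TTheory GRing.Theory Num.Theory.
Import numFieldNormedType.Exports.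
(* Otherwise [form] is the one of MathComp's [sesquilinear]. *)
Import Defs.

Set Implicit Arguments.
Unset Strict Implicit.
Unset Printing Implicit Defensive.

Local Open Scope classical_set_scope.
Local Open Scope ring_scope.

(** * Bilinear forms, semidefiniteness and the Rayleigh quotient *)

Section Forms.
Context {R : realType} {n : nat}.
Implicit Types (g T S : 'M[R]_n) (u v w : 'rV[R]_n) (a b c : R) (s : seq R).

Lemma formDl T u v w : form T (u + v) w = form T u w + form T v w.
Proof. by rewrite /form !mulmxDl mxE. Qed.

Lemma formZl T a v w : form T (a *: v) w = a * form T v w.
Proof. by rewrite /form -!scalemxAl mxE. Qed.

Lemma formDr T u v w : form T u (v + w) = form T u v + form T u w.
Proof. by rewrite /form linearD /= mulmxDr mxE. Qed.

Lemma formZr T a v w : form T v (a *: w) = a * form T v w.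
Proof. by rewrite /form linearZ /= -scalemxAr mxE. Qed.

Lemma formB T g v w : form (T - g) v w = form T v w - form g v w.
Proof. by rewrite /form mulmxBr mulmxBl !mxE. Qed.

Lemma formZ T a v w : form (a *: T) v w = a * form T v w.
Proof. by rewrite /form -scalemxAr -scalemxAl mxE. Qed.

Lemma form_mulmx g S v w : form g (v *m S) w = form (S *m g) v w.
Proof. by rewrite /form -!mulmxA. Qed.

(** The value is the sum of the squares of the coordinates of [v *m T]. *)
Lemma form_self_eq0 T v : form T v (v *m T) = 0 -> v *m T = 0.
Proof.
rewrite /form mxE => /eqP; rewrite psumr_eq0 => [/allP sq0|i _]; last first.
  by rewrite [_^T _ _]mxE -expr2 sqr_ge0.
apply/rowP => i; have := sq0 i (mem_index_enum _).
by rewrite /= [_^T _ _]mxE -expr2 sqrf_eq0 [RHS]mxE => /eqP.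
Qed.

Lemma positive_form_unitmx g : positive_form g -> g \in unitmx.
Proof.
move=> [_ g_gt0]; rewrite -row_free_unit; apply: inj_row_free => v vg0.
apply/eqP/negPn/negP => /g_gt0.
by rewrite /form vg0 mul0mx mxE ltxx.
Qed.

Lemma symmetric_assoc_op g T : positive_form g ->
  symmetric_op g (assoc_op g T) <-> symmetric_form T.
Proof.
move=> g_pos; have gU := positive_form_unitmx g_pos; have [g_sym _] := g_pos.
have assocE v w : form g (v *m assoc_op g T) w = form T v w.
  by rewrite form_mulmx /assoc_op mulmxKV.
split=> symT v w.
  by rewrite -assocE symT g_sym assocE.
by rewrite assocE g_sym assocE.
Qed.

Lemma symmetric_op_affine g S c b : symmetric_op g S ->
  symmetric_op g (c%:M - b *: S).
Proof.
move=> symS v w.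
rewrite !mulmxBr !mul_mx_scalar -!scalemxAr -!scaleNr formDl formDr.
by rewrite !formZl !formZr symS.
Qed.

(** Perturb [v] along w = vQ: with b = Q(v, w) and q = Q(w, w), Q(v + tw, v + tw) = 2tb + t^2 q. At
    t = -b/(q + 1) this is -b^2 (q + 2)/(q + 1)^2, so b = 0, and b is the squared Euclidean norm of
    vQ. Using q + 1 rather than q avoids the case q = 0. *)
Lemma semidefinite_null Q v : symmetric_form Q ->
  (forall w, 0 <= form Q w w) -> form Q v v = 0 -> v *m Q = 0.
Proof.
move=> Qsym Qge0 Qv0; apply: form_self_eq0; set w := v *m Q.
have := Qge0 w; set q := form Q w w => q_ge0.
have q1_gt0 : 0 < q + 1 by rewrite ltr_wpDl.
set b := form Q v w.
have := Qge0 (v + (- b / (q + 1)) *: w).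
rewrite !(formDl, formDr, formZl, formZr) Qv0 [form Q w v]Qsym -/b -/q.
have -> : 0 + - b / (q + 1) * b + (- b / (q + 1) * b + - b / (q + 1) *
    (- b / (q + 1) * q)) = - (b ^+ 2 * ((q + 2) / (q + 1) ^+ 2)).
  by field; rewrite gt_eqF.
rewrite oppr_ge0 pmulr_lle0; last by rewrite divr_gt0 ?exprn_gt0 // ltr_wpDl.
by move=> b2_le0; apply/eqP; rewrite -sqrf_eq0 eq_le b2_le0 sqr_ge0.
Qed.

Lemma form_continuous T : continuous (fun v => form T v v).
Proof.
have -> : (fun v => form T v v) =
    (fun v => \sum_j (\sum_i v 0 i * T i j) * v 0 j).
  by apply: boolp.funext => v; rewrite /form mxE; apply: eq_bigr => j _;
    rewrite !mxE.
have coordC j : continuous (fun v : 'rV[R]_n => v 0 j).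
  exact: coord_continuous.
apply: continuous_big => [|j _]; first exact: add_continuous.
move=> v; apply: (@continuousM R 'rV[R]_n); last exact: coordC.
apply: continuous_big => [|i _]; first exact: add_continuous.
move=> {}v; apply: (@continuousM R 'rV[R]_n); first exact: coordC.
exact: cst_continuous.
Qed.

(* [a] is the minimum, attained at [u], of the Rayleigh quotient
   [form T w w / form g w w] on the unit sphere. *)
Lemma lowest_eigenvalue g T : positive_form g -> symmetric_form T ->
  forall v0, v0 != 0 -> exists a u, [/\ u != 0, u *m T = a *: (u *m g)
    & forall w, a * form g w w <= form T w w].
Proof.
move=> [g_sym g_gt0] T_sym v0 v0_neq0.
(* The norm on rows is the sup norm, not that of [g]. Its unit sphere is compact and meets every
   ray, which suffices because [f] is invariant under scaling. *)
pose A := [set v : 'rV[R]_n | `|v| = 1].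
pose f v := form T v v / form g v v.
have A_neq0 v : A v -> v != 0.
  by move=> Av; rewrite -normr_eq0 Av oner_eq0.
have normA v : v != 0 -> A (`|v|^-1 *: v).
  by move=> v_neq0; rewrite /A /= normrZ normfV normr_id mulVf ?normr_eq0.
have cA : compact A.
  apply: bounded_closed_compact.
    by exists 1; split=> // x x_gt1 v /= ->; exact: ltW.
  have /continuous_closedP := @norm_continuous R 'rV[R]_n.
  by move=> /(_ [set x | x = 1]); apply; exact: closed_eq.
have cf : {within A, continuous f}.
  apply: continuous_in_subspaceT => v; rewrite inE => /A_neq0 v_neq0.
  have gV : {for v, continuous (fun w => (form g w w)^-1)}.
    apply: (@continuousV R 'rV[R]_n); last exact: form_continuous.
    by rewrite gt_eqF ?g_gt0.
  exact: (@continuousM R 'rV[R]_n _ _ v (@form_continuous T v) gV).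
have [|u uA umin] := EVT_min_rV _ cA cf.
  by exists (`|v0|^-1 *: v0); exact: normA.
have u_neq0 : u != 0 by apply: A_neq0; rewrite inE in uA.
have Tge w : f u * form g w w <= form T w w.
  have [->|w_neq0] := eqVneq w 0.
    by rewrite /form !mul0mx mxE mulr0.
  rewrite -ler_pdivlMr ?g_gt0 //.
  have -> : form T w w / form g w w = f (`|w|^-1 *: w).
    rewrite /f !formZl !formZr; field.
    by rewrite normr_eq0 w_neq0 gt_eqF ?g_gt0.
  by apply: umin; rewrite inE; exact: normA.
exists (f u), u; split=> //.
(* T - f(u) g is positive semidefinite and vanishes on (u, u), so [u] lies in its kernel. *)
apply/eqP; rewrite -subr_eq0 scalemxAr -mulmxBr; apply/eqP.
apply: semidefinite_null => [v w|w|].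
- by rewrite !formB !formZ T_sym g_sym.
- by rewrite formB formZ subr_ge0.
- by rewrite formB formZ /f divfK ?subrr // gt_eqF ?g_gt0.
Qed.

End Forms.

(** * Spectra under affine maps of an operator *)

Section Spectrum.
Context {R : realType} {n : nat}.
Implicit Types (g T S : 'M[R]_n) (v w : 'rV[R]_n) (a b c : R) (s : seq R).

Lemma size_spectrum S s : ordered_spectrum S s -> size s = n.
Proof.
move=> [_ chS]; have := size_char_poly S.
by rewrite chS size_prod_XsubC => -[].
Qed.

Lemma trace_spectrum S s : (0 < n)%N -> ordered_spectrum S s ->
  \tr S = \sum_(a <- s) a.
Proof.
move=> n_gt0 Ss; have := char_poly_trace S n_gt0; have szs := size_spectrum Ss.
have [_ ->] := Ss; rewrite -[X in _`_X.-1]szs coefPn_prod_XsubC ?szs -?lt0n //.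
by move/oppr_inj.
Qed.

(** With q = -(X - c)/b, the matrix X - (c - bS) is -b (q - S), so its determinant is (-b)^n times
    the characteristic polynomial of [S] composed with q. *)
Lemma char_poly_affine S c b s : b != 0 ->
  char_poly S = \prod_(a <- s) ('X - a%:P) ->
  char_poly (c%:M - b *: S) = \prod_(a <- [seq c - b * a | a <- s]) ('X - a%:P).
Proof.
move=> b_neq0 chS; pose q : {poly R} := - b^-1 *: ('X - c%:P).
have szs : size s = n.
  by have := size_char_poly S; rewrite chS size_prod_XsubC => -[].
have qE : (- b)%:P * q = 'X - c%:P.
  by rewrite mul_polyC /q scalerA mulrNN divff // scale1r.
have chE : char_poly_mx (c%:M - b *: S) =
    (- b)%:P *: map_mx (comp_poly q) (char_poly_mx S).
  apply/matrixP => i j.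
  rewrite !mxE comp_polyB comp_polyC mulrBr.
  case: (i == j); rewrite ?mulr1n ?mulr0n ?comp_polyX ?comp_poly0 ?qE.
    by rewrite !(polyCB, polyCN, polyCM); ring.
  by rewrite !(polyCB, polyCN, polyCM); ring.
rewrite /char_poly chE detZ det_map_mx -/(char_poly S) chS.
(* As [s] has n entries, (-b)^n gives one factor -b per root, and -b (q - a) = X - (c - b a). *)
rewrite rmorph_prod big_map -szs -iter_mulr_1 -count_predT
  -big_const_seq -big_split /=.
apply: eq_bigr => a _.
by rewrite comp_polyB comp_polyX comp_polyC mulrBr qE polyCN polyCB polyCM; ring.
Qed.

Lemma ordered_spectrum_affine S c b s : 0 < b -> ordered_spectrum S s ->
  ordered_spectrum (c%:M - b *: S) (rev [seq c - b * a | a <- s]).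
Proof.
move=> b_gt0 [s_sorted chS]; split.
  rewrite rev_sorted sorted_map; apply: sub_sorted s_sorted => x y /=.
  by rewrite lerD2l lerN2 ler_pM2l.
rewrite (char_poly_affine c _ chS) ?gt_eqF //.
by rewrite big_rev.
Qed.

(* Since [c] is the trace, the k lowest eigenvalues c - k a_i come from the k
   largest a_i, and k c minus k times their sum is k times the rest. *)
Lemma sum_lowest_trace k s : (k <= size s)%N ->
  let c := \sum_(a <- s) a in
  \sum_(a <- take k (rev [seq c - k%:R * a | a <- s])) a =
  k%:R * \sum_(a <- take (size s - k) s) a.
Proof.
move=> le_ks c; rewrite take_rev size_map big_rev -map_drop big_map /=.
rewrite sumrB big_const_seq count_predT size_drop subKn // iter_addr_0.
rewrite -mulr_sumr -[c *+ k]mulr_natl -mulrBr; congr (_ * _).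
by rewrite /c -{1}(cat_take_drop (size s - k) s) big_cat /= addrK.
Qed.

Lemma m_positive_trace g S k : (0 < k < n)%N ->
  m_positive_op g (n - k) S <->
  m_positive_op g k ((\tr S)%:M - k%:R *: S).
Proof.
move=> /andP[k_gt0 lt_kn].
have n_gt0 : (0 < n)%N by apply: leq_trans lt_kn.
have kR_gt0 : 0 < k%:R :> R by rewrite ltr0n.
have kR_neq0 : k%:R != 0 :> R by rewrite gt_eqF.
have spec s : ordered_spectrum S s ->
    ordered_spectrum ((\tr S)%:M - k%:R *: S)
      (rev [seq \tr S - k%:R * a | a <- s]) /\
    \sum_(a <- take k (rev [seq \tr S - k%:R * a | a <- s])) a =
    k%:R * \sum_(a <- take (n - k) s) a.
  move=> Ss; split; first exact: ordered_spectrum_affine.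
  rewrite (trace_spectrum n_gt0 Ss) -(size_spectrum Ss) sum_lowest_trace //.
  by rewrite (size_spectrum Ss) ltnW.
split=> -[symS [s Ss s_gt0]].
  split; first exact: symmetric_op_affine.
  have [Ss' sumE] := spec s Ss; exists (rev [seq \tr S - k%:R * a | a <- s]) => //.
  by rewrite sumE mulr_gt0.
(* For the converse, the spectrum of [S] must be produced from the given one: [S] is in turn an
   affine function of tr S - kS, of the same shape, with positive coefficient 1/k. *)
have SE : S = (\tr S / k%:R)%:M - k%:R^-1 *: ((\tr S)%:M - k%:R *: S).
  rewrite scalerBr scalerA mulVf // scale1r scale_scalar_mx mulrC opprB.
  by rewrite addrC subrK.
split; first by rewrite SE; exact: symmetric_op_affine.
pose s' := rev [seq \tr S / k%:R - k%:R^-1 * a | a <- s].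
have Ss' : ordered_spectrum S s'.
  by rewrite SE; apply: ordered_spectrum_affine; rewrite ?invr_gt0.
(* The two affine maps are mutually inverse and both reverse order, so the list that [spec] builds
   from [s'] is [s] itself. *)
exists s' => //; have [_] := spec s' Ss'.
rewrite /s' map_rev revK -map_comp map_id_in => [sumE|a _ /=]; last by field.
by rewrite -(pmulr_rgt0 _ kR_gt0) -sumE.
Qed.

Lemma spectrum_eigenvalue S s a v : ordered_spectrum S s -> v != 0 ->
  v *m S = a *: v -> a \in s.
Proof.
move=> [_ chS] v_neq0 vS; rewrite -root_prod_XsubC -chS -eigenvalue_root_char.
by apply/eigenvalueP; exists v.
Qed.

End Spectrum.

(** * Reality and positivity of eigenvalues, through complex eigenvectors *)

Section RealSpectrum.
Import complex.
Context {R : realType} {n : nat}.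
Implicit Types (g T : 'M[R]_n).
Local Notation C := (complex R).
Local Notation toC := (real_complex R).

Lemma Re_mulmx (v : 'rV[C]_n) T :
  map_mx (@Re R) (v *m map_mx toC T) = map_mx (@Re R) v *m T.
Proof.
apply/rowP => j; rewrite !mxE (big_morph (@Re R) (id1 := 0) (op1 := +%R)) //.
  by apply: eq_bigr => i _; rewrite !mxE; case: (v 0 i) => x y /=; ring.
by move=> [x y] [x' y'].
Qed.

Lemma Im_mulmx (v : 'rV[C]_n) T :
  map_mx (@Im R) (v *m map_mx toC T) = map_mx (@Im R) v *m T.
Proof.
apply/rowP => j; rewrite !mxE (big_morph (@Im R) (id1 := 0) (op1 := +%R)) //.
  by apply: eq_bigr => i _; rewrite !mxE; case: (v 0 i) => x y /=; ring.
by move=> [x y] [x' y'].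
Qed.

(** For an eigenvector a + ib with eigenvalue x + iy, T(a, b) = T(b, a) gives y (g(a, a) + g(b, b))
    = 0, hence y = 0. Then T(a, a) + T(b, b) = x (g(a, a) + g(b, b)) with both sums positive. *)
Lemma assoc_op_complex_eigenvalue g T (z : C) : positive_form g ->
  positive_form T -> root (map_poly toC (char_poly (assoc_op g T))) z ->
  0 < Re z /\ Im z = 0.
Proof.
move=> g_pos [T_sym T_gt0]; have [g_sym g_gt0] := g_pos.
have gU := positive_form_unitmx g_pos.
rewrite map_char_poly -eigenvalue_root_char => /eigenvalueP[v vS v_neq0].
have vT : v *m map_mx toC T = z *: v *m map_mx toC g.
  by rewrite -vS /assoc_op map_mxM -!mulmxA -map_mxM mulVmx // map_mx1 mulmx1.
pose a := map_mx (@Re R) v; pose b := map_mx (@Im R) v.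
set x := Re z; set y := Im z.
have aT : a *m T = (x *: a - y *: b) *m g.
  rewrite -Re_mulmx vT Re_mulmx; congr (_ *m _); apply/rowP => i.
  by rewrite !mxE /x /y; case: (z); case: (v 0 i).
have bT : b *m T = (y *: a + x *: b) *m g.
  rewrite -Im_mulmx vT Im_mulmx; congr (_ *m _); apply/rowP => i.
  by rewrite !mxE /x /y; case: (z) => ? ?; case: (v 0 i) => ? ? /=; ring.
have Ta w : form T a w = x * form g a w - y * form g b w.
  by rewrite /form aT -/(form g _ w) formDl -scaleNr !formZl mulNr.
have Tb w : form T b w = y * form g a w + x * form g b w.
  by rewrite /form bT -/(form g _ w) formDl !formZl.
have form_ge0 (h : 'M[R]_n) u : positive_form h -> 0 <= form h u u.
  move=> [_ h_gt0]; have [->|/h_gt0/ltW//] := eqVneq u 0.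
  by rewrite /form !mul0mx mxE.
have ab_gt0 h : positive_form h -> 0 < form h a a + form h b b.
  move=> h_pos; have [_ h_gt0] := h_pos.
  have [a0|/h_gt0 ?] := eqVneq a 0; last by rewrite ltr_wpDr ?form_ge0.
  have [b0|/h_gt0 ?] := eqVneq b 0; last by rewrite ltr_wpDl ?form_ge0.
  case/eqP: v_neq0; apply/rowP => i.
  move: (congr1 (fun u : 'rV_n => u 0 i) a0) (congr1 (fun u : 'rV_n => u 0 i) b0).
  by rewrite !mxE; case: (v 0 i) => ? ? /= -> ->.
have y0 : y = 0.
  have := T_sym a b; rewrite Ta Tb (g_sym b a) => /eqP.
  rewrite -subr_eq0 => /eqP E.
  have : y * (form g a a + form g b b) = 0 by rewrite -oppr0 -E; ring.
  by move/eqP; rewrite mulf_eq0 (gt_eqF (ab_gt0 g g_pos)) orbF => /eqP.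
split=> //; have := ab_gt0 T (conj T_sym T_gt0).
rewrite Ta Tb y0 !mul0r subr0 add0r -mulrDr pmulr_lgt0 //.
exact: ab_gt0.
Qed.

(** The characteristic polynomial splits over the complex numbers with real roots, and this
    factorization descends because the embedding of real polynomials is injective. *)
Lemma positive_form_spectrum g T : positive_form g -> positive_form T ->
  exists2 s, ordered_spectrum (assoc_op g T) s & {in s, forall a, 0 < a}.
Proof.
move=> g_pos T_pos; pose p := char_poly (assoc_op g T).
have [r rE] := closed_field_poly_normal (map_poly toC p).
have root_r z : z \in r -> 0 < Re z /\ Im z = 0.
  move=> zr; apply: (assoc_op_complex_eigenvalue g_pos T_pos).
  by rewrite -/p rE rootZ ?root_prod_XsubC // lead_coef_eq0 map_poly_eq0
    monic_neq0 // char_poly_monic.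
exists (sort <=%R (map (@Re R) r)) => [|a]; last first.
  by rewrite mem_sort => /mapP[z /root_r[z_gt0 _] ->].
split; first exact/sort_sorted/le_total.
have lead1 : lead_coef (map_poly toC p) = 1.
  by rewrite lead_coef_map (monicP (char_poly_monic _)) rmorph1.
rewrite (perm_big _ (permEl (perm_sort _ _))) /= big_map.
apply: (map_poly_inj toC); rewrite -/p rE lead1 scale1r map_prod_XsubC.
rewrite big_seq [RHS]big_seq; apply: eq_bigr => z /root_r[_ Imz].
by congr ('X - _%:P); apply/eqP; rewrite eq_complex Imz /= !eqxx.
Qed.

End RealSpectrum.

(** * From pointwise algebra to the manifold *)

Lemma positive_form_1_positive (R : realType) n (g T : 'M[R]_n) : (0 < n)%N ->
  positive_form g -> positive_form T <-> m_positive_op g 1 (assoc_op g T).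
Proof.
move=> n_gt0 g_pos; have gU := positive_form_unitmx g_pos.
split=> [T_pos | [/(symmetric_assoc_op _ g_pos) T_sym [s Ss s_gt0]]].
  split; first by apply/(symmetric_assoc_op _ g_pos); case: T_pos.
  have [s Ss s_gt0] := positive_form_spectrum g_pos T_pos.
  exists s => //; move: (size_spectrum Ss) s_gt0.
  case: s {Ss} => [/= n0|a s _ s_gt0]; first by rewrite -n0 in n_gt0.
  by rewrite /= take0 big_seq1 s_gt0 ?mem_head.
split=> // v v_neq0.
have [a [u [u_neq0 uT T_ge]]] := lowest_eigenvalue g_pos T_sym v_neq0.
(* The minimum [a] of the Rayleigh quotient is an eigenvalue, so it is at least the head of the
   sorted list [s], which is positive by hypothesis. *)
have a_s : a \in s.
  apply: (spectrum_eigenvalue Ss u_neq0).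
  by rewrite mulmxA uT -scalemxAl mulmxK.
have a_gt0 : 0 < a.
  case: s Ss s_gt0 a_s => // b s [/= b_path _].
  rewrite take0 big_seq1 => b_gt0; rewrite inE => /predU1P[->//|a_s].
  have := order_path_min le_trans b_path.
  by move=> /allP/(_ a a_s); exact: lt_le_trans.
apply: lt_le_trans (T_ge v); rewrite mulr_gt0 //.
by case: g_pos => _; apply.
Qed.

Lemma assoc_op_ein (R : realType) n (g : 'rV[R]_n -> 'M[R]_n) k x :
  g x \in unitmx ->
  let S := assoc_op (g x) (ricci_coord g x) in
  assoc_op (g x) (ein_coord g k x) = (\tr S)%:M - k%:R *: S.
Proof.
move=> gU; rewrite /assoc_op /ein_coord mulmxBl -!scalemxAl mulmxV //.
by rewrite scalemx1.
Qed.

Theorem proposition2p5 (R : realType) (n : nat) (M : riemannianManifold R n) :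
  (forall k : nat, (1 <= k <= n - 1)%N ->
     (m_positive_tensor M (n - k)%N (Ric M)
      <-> m_positive_tensor M k (Ein M k)))
  /\ ((2 <= n)%N ->
     (positive_tensor M (Ric M)
      <-> m_positive_tensor M (n - 1)%N (Ein M (n - 1)%N)))
  /\ ((3 <= n)%N ->
     (m_positive_tensor M (n - 2)%N (Ric M)
      <-> m_positive_tensor M 2 (Ein M 2))).
Proof.
have main k : (1 <= k <= n - 1)%N ->
    (m_positive_tensor M (n - k)%N (Ric M) <-> m_positive_tensor M k (Ein M k)).
  move=> /andP[k_gt0 le_kn].
  have k_lt : (0 < k < n)%N by lia.
  by split=> posM p c cA cp; move: (posM p c cA cp) => /=;
    rewrite /Ein assoc_op_ein ?(positive_form_unitmx (metric_inner cA cp)) //;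
    move/(m_positive_trace _ _ k_lt).
split=> //; split=> n_ge; last by apply: main; lia.
have n_gt0 : (0 < n)%N by exact: ltnW.
(* At k = n - 1, [main] replaces the Einstein side by (n - (n - 1))-positive Ricci curvature, which
   is 1-positivity. *)
rewrite -main; last by rewrite leqnn andbT subn_gt0.
rewrite subKn //.
by split=> posM p c cA cp; have := posM p c cA cp;
  move/(positive_form_1_positive _ n_gt0 (metric_inner cA cp)).
Qed.
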